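(* Let $p<q$ be primes, let $Q$ be a prime power, and let $L=\mathbb{F}_{Q^{pq}}$. For every integer $m$ with $q\le m<pq$, the number of $m$-dimensional Chowla $\mathbb{F}_Q$-subspaces of $L$ is $$\sum_{a=0}^{q}\sum_{b=0}^{p}(-1)^{a+b}Q^{\binom{a}{2}+\binom{b}{2}}\left(N_{a,b}^{(0)}\genfrac{[}{]}{0pt}{}{pq-a-b}{m-a-b}_{Q}+N_{a,b}^{(1)}\genfrac{[}{]}{0pt}{}{pq-a-b+1}{m-a-b+1}_{Q}\right),$$ where $$N_{a,b}^{(1)}=\genfrac{[}{]}{0pt}{}{q-1}{a-1}_{Q}\genfrac{[}{]}{0pt}{}{p-1}{b-1}_{Q}$$ and $$N_{a,b}^{(0)}=\genfrac{[}{]}{0pt}{}{q}{a}_{Q}\genfrac{[}{]}{0pt}{}{p}{b}_{Q}-\genfrac{[}{]}{0pt}{}{q-1}{a-1}_{Q}\genfrac{[}{]}{0pt}{}{p-1}{b-1}_{Q}.$$ Gaussian binomial coefficients with negative lower index are interpreted as zero.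
   Context: For a finite field extension $K\subseteq L$ with $[L:K]>1$, a nonzero $K$-subspace $A\subseteq L$ is called a Chowla subspace if $[K(a):K]>\dim_K A$ for every $0\ne a\in A$. Here $K=\mathbb{F}_Q$. The Gaussian binomial coefficient $\genfrac{[}{]}{0pt}{}{s}{t}_{Q}$ is the number of $t$-dimensional subspaces of an $s$-dimensional vector space over $\mathbb{F}_Q$; it is zero when $t<0$ or $t>s$. *)

(* Defs.v *)
(* Mathematical Components. *)
From HB Require Import structures.
From mathcomp Require Import all_boot all_order all_algebra all_field.

Set Implicit Arguments.
Unset Strict Implicit.
Unset Printing Implicit Defensive.

Import GRing.Theory.
Local Open Scope ring_scope.

(* A subspace is stored as its canonical square matrix of coordinates, so a
   vector space over a finite field has a finite type of subspaces. *)
HB.instance Definition _ (K : finFieldType) (vT : vectType K) :=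
  isCountable.Build {vspace vT}
    (pcan_pickleK (can_pcan (@VectorInternalTheory.vs2mxK K vT))).
HB.instance Definition _ (K : finFieldType) (vT : vectType K) :=
  isFinite.Build {vspace vT}
    (pcan_enumP (can_pcan (@VectorInternalTheory.vs2mxK K vT))).

(* <<1; a>> is K(a), 1 being the image of K in L. *)
Definition Chowla (K : fieldType) (L : fieldExtType K) (A : {vspace L}) :=
  A != 0%VS /\
  forall a : L, a \in A -> a != 0 -> (\dim A < \dim <<1; a>>)%N.

(* finvect_type L is L itself, with its finite type structure. *)
Definition chowlab (K : finFieldType) (L : fieldExtType K) (A : {vspace L}) :=
  (A != 0%VS) &&
  [forall a : finvect_type L,
     ((a : L) \in A) && ((a : L) != 0) ==>
     (\dim A < \dim <<1; (a : L)>>)%N].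

Lemma chowlaP (K : finFieldType) (L : fieldExtType K) (A : {vspace L}) :
  reflect (Chowla A) (chowlab A).
Proof.
apply: (iffP andP) => -[nzA H]; split=> //.
  by move=> a aA nza; move/forallP/(_ a)/implyP: H; apply; rewrite aA nza.
by apply/forallP => a; apply/implyP => /andP[aA nza]; apply: H.
Qed.

(* Gaussian binomial coefficient [s, t]_Q for Q = #|K|; it is zero when t < 0
   or t > s. *)
Definition gauss_bin (K : finFieldType) (s : nat) (t : int) : nat :=
  #|[set U : {vspace 'rV[K]_s} | (\dim U)%:Z == t]|.

Definition N1 (K : finFieldType) (p q a b : nat) : int :=
  (gauss_bin K (q - 1) (a%:Z - 1) * gauss_bin K (p - 1) (b%:Z - 1))%N%:Z.

Definition N0 (K : finFieldType) (p q a b : nat) : int :=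
  (gauss_bin K q a%:Z * gauss_bin K p b%:Z)%N%:Z - N1 K p q a b.

(* Main.v *)
Require Import Defs.
From HB Require Import structures.
From mathcomp Require Import all_boot all_order all_algebra.
From mathcomp Require Import all_fingroup all_solvable all_field.
From mathcomp Require Import ring.

(** The degree of an element of L divides p * q, so an element fails to have
    degree greater than m, for q <= m < p * q, exactly when it lies in the
    subfield E of degree p or in the subfield F of degree q: over a finite field
    these subfields exist and each contains every subfield whose degree divides
    its own.  Hence a subspace of dimension m is a Chowla subspace if and only if
    it meets both E and F trivially (chowlab_dim), and the theorem reduces to a
    count in linear algebra: two subspaces U and V meeting in a line <[v]> are
    given, and one counts the m-dimensional subspaces A with
    U :&: A = V :&: A = 0.

    The count is a Moebius inversion.  The weight mu X = (-1)^d Q^(d choose 2),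
    for d = \dim X, is the Moebius function of the subspace lattice between 0 and
    X: its sum over the subspaces of W vanishes unless W = 0 (sum_vmoebius).
    Applied to U :&: A and to V :&: A, this turns the count into the sum over
    X <= U and Y <= V of mu X * mu Y times the number of m-dimensional A
    containing X + Y (card_trivial_meets).  That number is a Gaussian binomial
    coefficient, since the subspaces above X + Y correspond to those of the
    quotient (card_vspace_interval).  As X :&: Y lies in the line U :&: V, the
    dimension of X + Y is \dim X + \dim Y, or one less when X and Y both
    contain v; collecting the pairs by their dimensions a and b gives the two
    kinds of terms, with multiplicities N0 and N1 (card_trivial_meets_line). *)

Set Implicit Arguments.
Unset Strict Implicit.
Unset Printing Implicit Defensive.

Import GRing.Theory.
Local Open Scope ring_scope.

(** * Subspaces between two given subspaces *)

(** A coordinate model of the quotient V / W, so that its subspaces are those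
    counted by gauss_bin: project V along W onto a complement, then read off
    coordinates. *)
Lemma quotient_map_exists (K : fieldType) (vT : vectType K)
    (W V : {vspace vT}) : (W <= V)%VS ->
  exists f : 'Hom(vT, 'rV[K]_(\dim V - \dim W)),
    (V :&: lker f)%VS = W /\ (f @: V)%VS = fullv.
Proof.
move=> sWV; set n := (\dim V - \dim W)%N.
pose C := (V :\: W)%VS.
have dimC : \dim C = n.
  by have := dimv_cap_compl V W; rewrite (capv_idPr sWV) /n => <-; rewrite addKn.
have CW0 : (C :&: W = 0)%VS by apply: capv_diff.
have addCW : (C + W)%VS = V by rewrite addv_diff; apply/addv_idPl.
have dimR : \dim (fullv : {vspace 'rV[K]_n}) = n by rewrite dimvf /dim /= mul1n.
have [g gE] := linear_of_free (vbasis C) (vbasis (fullv : {vspace 'rV[K]_n})).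
have {}gE := gE (basis_free (vbasisP C)) _.
have {}gE : map g (vbasis C) = vbasis fullv by apply: gE; rewrite !size_tuple dimC dimR.
pose f := (linfun g \o daddv_pi C W)%VF.
have fC c : c \in C -> f c = g c.
  by move=> cC; rewrite comp_lfunE lfunE /= daddv_pi_id.
have imC : (f @: C)%VS = fullv.
  rewrite (_ : f @: C = linfun g @: C)%VS; last first.
    by apply: eq_in_limg => c /fC ->; rewrite lfunE.
  rewrite -{1}(span_basis (vbasisP C)) limg_span.
  by rewrite (eq_map (lfunE g)) gE (span_basis (vbasisP _)).
have imV : (f @: V)%VS = fullv.
  by apply/eqP; rewrite eqEsubv subvf -imC limgS // diffvSl.
exists f; split=> //; apply/eqP; rewrite eq_sym eqEdim subv_cap sWV /=.
apply/andP; split.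
  apply/subvP => w wW; rewrite memv_ker comp_lfunE lfunE /=.
  have := daddv_pi_add CW0 (subvP (addvSr C W) w wW).
  have /daddv_pi_id -> // : (W :&: C = 0)%VS by rewrite capvC.
  by move/eqP; rewrite addrC -subr_eq0 addrAC subrr add0r => /eqP ->; rewrite linear0.
by have := limg_ker_dim f V; rewrite imV dimR => E; rewrite -(leq_add2r n) E /n subnKC ?dimvS.
Qed.

(** The image and the preimage under a map with kernel W on V and full image are
    inverse bijections between the subspaces A with W <= A <= V and the
    subspaces of the coordinate space of V / W; they shift dimensions by
    \dim W. *)
Lemma card_vspace_interval (K : finFieldType) (vT : vectType K)
    (W V : {vspace vT}) (t : int) : (W <= V)%VS ->
  #|[set A : {vspace vT} | (W <= A <= V)%VS && ((\dim A)%:Z == t)]| =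
  gauss_bin K (\dim V - \dim W) (t - (\dim W)%:Z).
Proof.
move=> sWV; have [f [kerf imf]] := quotient_map_exists sWV.
have preK A : (W <= A <= V)%VS -> (V :&: f @^-1: (f @: A))%VS = A.
  case/andP=> sWA sAV; apply/vspaceP => x; rewrite memv_cap -memv_preim.
  apply/andP/idP => [[xV /memv_imgP[a aA fxa]] | xA].
    rewrite -(subrK a x) rpredD // (subvP sWA) // -kerf memv_cap.
    by rewrite memv_ker linearB /= fxa subrr eqxx rpredB // (subvP sAV).
  by rewrite (subvP sAV) ?memv_img.
have dim_im A : (W <= A <= V)%VS -> (\dim A = \dim W + \dim (f @: A))%N.
  case/andP=> sWA sAV; rewrite -(limg_ker_dim f A); congr (\dim _ + _)%N.
  rewrite -[RHS](capv_idPr sWA) -[in RHS]kerf capvA.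
  by congr (_ :&: _)%VS; apply/esym/capv_idPl.
rewrite /gauss_bin -(card_in_imset (f := fun A => (f @: A)%VS)); last first.
  move=> A B; rewrite !inE => /andP[sA _] /andP[sB _] eqAB.
  by rewrite -(preK A) // eqAB preK.
congr #|pred_of_set _|; apply/setP => B; rewrite inE; apply/imsetP/idP.
  case=> A; rewrite inE => /andP[sA /eqP <-] ->.
  by rewrite (dim_im A sA) PoszD addrC addKr.
move=> /eqP dimB; pose A := (V :&: f @^-1: B)%VS.
have sA : (W <= A <= V)%VS.
  rewrite capvSl subv_cap sWV /= andbT -{1}kerf; apply/subvP => x.
  by rewrite memv_cap memv_ker -memv_preim => /andP[_ /eqP ->]; rewrite mem0v.
have fA : (f @: A)%VS = B.
  apply/vspaceP => y; apply/memv_imgP/idP => [[x] | yB].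
    by rewrite memv_cap -memv_preim => /andP[_ fxB] ->.
  have /memv_imgP[x xV yE] : y \in (f @: V)%VS by rewrite imf memvf.
  by exists x => //; rewrite memv_cap xV -memv_preim -yE.
exists A => //; rewrite inE sA /= (dim_im A sA) fA PoszD dimB.
by rewrite addrC subrK.
Qed.

(** * Moebius inversion over subspaces *)

Lemma disjoint_line (K : fieldType) (vT : vectType K) (X : {vspace vT}) (v : vT) :
  v \notin X -> (X :&: <[v]> = 0)%VS.
Proof.
move=> vX; apply/eqP; rewrite -subv0; apply/subvP => x.
rewrite memv_cap memv0 => /andP[xX /vlineP[k xE]].
apply: contraR vX => nzx; have nzk : k != 0.
  by apply: contraNneq nzx => k0; rewrite xE k0 scale0r.
by rewrite -(scalerK nzk v) -xE rpredZ.
Qed.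

(** Fix one complement C of the line <[v]> in Z.  Any other complement is the
    graph of a linear form on C: it is spanned by the vectors e i + r i *: v, for
    e a basis of C, and the scalars r i are free and determined by it. *)
Lemma card_complements_line (K : finFieldType) (vT : vectType K)
    (Z : {vspace vT}) (v : vT) : v \in Z -> v != 0 ->
  #|[set X : {vspace vT} | ((X + <[v]>)%VS == Z) && (v \notin X)]| =
  (#|K| ^ (\dim Z).-1)%N.
Proof.
move=> vZ nzv; pose C := (Z :\: <[v]>)%VS; set n := (\dim Z).-1.
have svZ : (<[v]> <= Z)%VS by [].
have addC : (C + <[v]>)%VS = Z by rewrite addv_diff; apply/addv_idPl.
have dimC : \dim C = n.
  by have := dimv_cap_compl Z <[v]>; rewrite (capv_idPr svZ) dim_vline nzv /n => <-.
have dimX (X : {vspace vT}) : v \notin X -> \dim (X + <[v]>) = (\dim X).+1.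
  by move=> /disjoint_line X0; rewrite dimv_disjoint_sum // dim_vline nzv addn1.
have dimZ : \dim Z = n.+1.
  by rewrite -addC dimv_disjoint_sum ?capv_diff // dimC dim_vline nzv addn1.
pose e i := tnth (vbasis C) i.
pose Y (r : {ffun 'I_(\dim C) -> K}) :=
  (<<[seq (e i + r i *: v)%R | i : 'I_(\dim C)]>>)%VS.
have memY (r : {ffun _}) i : e i + r i *: v \in Y r.
  by apply: memv_span; apply/mapP; exists i; rewrite ?mem_enum.
have addY r : (Y r + <[v]>)%VS = Z.
  apply/eqP; rewrite eqEsubv subv_add svZ andbT; apply/andP; split.
    apply/span_subvP => x /mapP[i _ ->]; rewrite rpredD ?rpredZ //.
    by apply: (subvP (diffvSl Z <[v]>)); apply: vbasis_mem; apply: mem_tnth.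
  rewrite -{1}addC subv_add addvSr andbT -{1}(span_basis (vbasisP C)).
  apply/span_subvP => x /tnthP[i ->]; rewrite -[tnth _ i](addrK (r i *: v)).
  apply: rpredB; first exact: (subvP (addvSl _ _)).
  by rewrite rpredZ //; apply: (subvP (addvSr _ _)); apply: memv_line.
have dimYle r : (\dim (Y r) <= n)%N.
  by rewrite -dimC; apply: leq_trans (dim_span _) _; rewrite size_map size_enum_ord.
have vY r : v \notin Y r.
  apply/negP => vYr; have := addY r; move/addv_idPl: (vYr : (<[v]> <= Y r)%VS) => ->.
  by move=> YZ; have := dimYle r; rewrite YZ dimZ ltnn.
have dimY r : \dim (Y r) = n.
  by apply: succn_inj; rewrite -dimX // addY dimZ.
have Yinj : injective Y.
  move=> r s eqY; apply/ffunP => i; apply: contraNeq (vY r) => neq.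
  rewrite -subr_eq0 in neq; rewrite -(scalerK neq v) rpredZ //.
  have -> : (r i - s i) *: v = (e i + r i *: v) - (e i + s i *: v).
    by rewrite opprD addrACA subrr add0r scalerBl.
  by apply: rpredB; rewrite // eqY.
rewrite -dimC -[X in (_ ^ X)%N]card_ord -card_ffun.
transitivity #|[set Y r | r : {ffun 'I_(\dim C) -> K}]|; last by rewrite card_imset.
apply: eq_card => X; rewrite inE; apply/andP/imsetP => [[/eqP addX vX] | [r _ ->]].
  (* r i is read off from the component of e i on the line, along X *)
  have decomp i : exists k, e i + k *: v \in X.
    have eiZ : e i \in (X + <[v]>)%VS.
      by rewrite addX (subvP (diffvSl Z <[v]>)) // vbasis_mem // mem_tnth.
    have [x xX [w /vlineP[k ->] ->]] := memv_addP eiZ.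
    by exists (- k); rewrite scaleNr addrK.
  pose r := [ffun i => xchoose (decomp i)]; exists r => //; apply/esym/eqP.
  rewrite eqEdim dimY; apply/andP; split.
    by apply/span_subvP => x /mapP[i _ ->]; rewrite ffunE; apply: (xchooseP (decomp i)).
  by rewrite -ltnS -dimX // addX dimZ.
by rewrite addY eqxx vY.
Qed.

(** The Moebius function mu(0, X) of the lattice of subspaces. *)
Definition vmoebius (K : finFieldType) (vT : vectType K) (X : {vspace vT}) : int :=
  (-1) ^+ \dim X * #|K|%:Z ^+ 'C(\dim X, 2).

(** For v in W nonzero, group the subspaces X of W by Z = X + <[v]>.  The group
    of Z consists of Z itself and of the #|K| ^ (\dim Z - 1) complements of the
    line in Z; since 'C(d, 2) - 'C(d - 1, 2) = d - 1, their total weight is the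
    opposite of that of Z, so each group contributes 0. *)
Lemma sum_vmoebius (K : finFieldType) (vT : vectType K) (W : {vspace vT}) :
  \sum_(X : {vspace vT} | (X <= W)%VS) vmoebius X = (W == 0%VS)%:R.
Proof.
have [-> | nzW] := eqVneq W 0%VS.
  rewrite (big_pred1 0%VS) => [|X /=]; last by rewrite subv0.
  by rewrite /vmoebius dimv0 mulr1.
pose v := vpick W; have vW : v \in W by apply: memv_pick.
have nzv : v != 0 by rewrite vpick0.
rewrite (bigID (fun X : {vspace vT} => v \in X)) /=.
rewrite [X in _ + X](partition_big (fun X : {vspace vT} => (X + <[v]>)%VS)
  (fun Z : {vspace vT} => (Z <= W)%VS && (v \in Z))) /=; last first.
  move=> X /andP[sXW _]; rewrite subv_add sXW -memvE vW.
  by apply: (subvP (addvSr _ _)); apply: memv_line.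
rewrite -big_split big1 //= => Z /andP[sZW vZ].
have dimZ : \dim Z = (\dim Z).-1.+1.
  rewrite prednK // lt0n dimv_eq0; apply: contraNneq nzv => Z0.
  by rewrite -memv0 -Z0.
have dimX (X : {vspace vT}) : (X + <[v]>)%VS = Z -> v \notin X -> \dim X = (\dim Z).-1.
  move=> <- vX; rewrite dimv_disjoint_sum ?dim_vline ?nzv ?addn1 //.
  exact/disjoint_line.
rewrite (eq_bigr (fun _ => (-1) ^+ (\dim Z).-1 * #|K|%:Z ^+ 'C((\dim Z).-1, 2))); last first.
  by move=> X /andP[/andP[_ vX] /eqP XZ]; rewrite /vmoebius (dimX X).
rewrite sumr_const (_ : #|_| = (#|K| ^ (\dim Z).-1)%N); last first.
  rewrite -(card_complements_line vZ nzv); apply: eq_card => X.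
  rewrite !inE; apply/andP/andP => [[/andP[_ ->] ->] // | [/eqP XZ vX]].
  by rewrite XZ eqxx vX (subv_trans _ sZW) // -XZ addvSl.
rewrite /vmoebius {1 2}dimZ binS bin1 exprS exprD mulN1r -mulr_natr natrX.
by rewrite natz mulNr mulrA addNr.
Qed.

(** The indicator of U :&: A = 0 is the sum of vmoebius X over the X contained in
    both U and A; exchanging sums leaves, for each pair X, Y, the count of the
    subspaces A that contain X + Y. *)
Lemma card_trivial_meets (K : finFieldType) (vT : vectType K)
    (U V : {vspace vT}) (m : nat) :
  #|[set A : {vspace vT} |
      [&& (U :&: A)%VS == 0%VS, (V :&: A)%VS == 0%VS & \dim A == m]]|%:Z =
  \sum_(X : {vspace vT} | (X <= U)%VS) \sum_(Y : {vspace vT} | (Y <= V)%VS)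
    vmoebius X * vmoebius Y *
    (gauss_bin K (\dim {:vT} - \dim (X + Y)) (m%:Z - (\dim (X + Y)%VS)%:Z))%:Z.
Proof.
rewrite -sum1_card -natz natr_sum big_mkcond /=.
pose h (X Y A : {vspace vT}) : int :=
  vmoebius X * vmoebius Y * ((X + Y <= A)%VS && (\dim A == m))%:R.
transitivity (\sum_(A : {vspace vT}) \sum_(X : {vspace vT} | (X <= U)%VS)
                \sum_(Y : {vspace vT} | (Y <= V)%VS) h X Y A).
  apply: eq_bigr => A _; rewrite inE.
  have mu0 (W : {vspace vT}) : ((W :&: A)%VS == 0%VS)%:R =
      \sum_(X : {vspace vT} | (X <= W)%VS) vmoebius X * (X <= A)%VS%:R :> int.
    rewrite -sum_vmoebius (eq_bigl _ _ (fun X => subv_cap X W A)) big_mkcondr.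
    by apply: eq_bigr => X _; case: ifP; rewrite ?mulr1 ?mulr0.
  transitivity (((U :&: A)%VS == 0%VS)%:R * ((V :&: A)%VS == 0%VS)%:R * (\dim A == m)%:R : int).
    by rewrite -!natrM !mulnb -andbA; case: (andb _ _).
  rewrite !mu0 big_distrlr mulr_suml; apply: eq_bigr => X _ /=.
  rewrite mulr_suml; apply: eq_bigr => Y _; rewrite /h subv_add -!mulnb !natrM.
  ring.
rewrite exchange_big; apply: eq_bigr => X _.
rewrite exchange_big; apply: eq_bigr => Y _.
rewrite /h -mulr_sumr -(card_vspace_interval _ (subvf (X + Y)%VS)) -natr_sum natz.
rewrite -sum1_card [in RHS]big_mkcond; congr (_ * _%:Z); apply: eq_bigr => A _.
by rewrite inE subvf andbT eqz_nat; case: (andb _ _).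
Qed.

(** * Collecting the terms by dimension *)

Lemma sum_by_dim (K : finFieldType) (vT : vectType K) (U : {vspace vT})
    (F : {vspace vT} -> int) :
  \sum_(X : {vspace vT} | (X <= U)%VS) F X =
  \sum_(0 <= a < (\dim U).+1)
    \sum_(X : {vspace vT} | (X <= U)%VS && (\dim X == a)) F X.
Proof.
rewrite big_mkord (partition_big (fun X : {vspace vT} => inord (\dim X) : 'I_(\dim U).+1)
  predT) //=.
apply: eq_bigr => a _; apply: eq_bigl => X; apply: andb_id2l => sXU.
by rewrite -val_eqE /= inordK // ltnS dimvS.
Qed.

Lemma gauss_bin_vspace (K : finFieldType) (vT : vectType K) (U : {vspace vT}) (a : nat) :
  \sum_(X : {vspace vT} | (X <= U)%VS && (\dim X == a)) 1 =
  (gauss_bin K (\dim U) a)%:Z.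
Proof.
have := card_vspace_interval (Posz a) (sub0v U).
rewrite dimv0 subn0 subr0 => <-; rewrite -sum1_card -natz natr_sum.
by apply: eq_bigl => X; rewrite inE sub0v eqz_nat.
Qed.

(** Subspaces of U through v are the subspaces of U / <[v]>. *)
Lemma gauss_bin_vspace_line (K : finFieldType) (vT : vectType K)
    (U : {vspace vT}) (v : vT) (a : nat) : v != 0 -> v \in U ->
  \sum_(X : {vspace vT} | (X <= U)%VS && (\dim X == a)) (v \in X)%:R =
  (gauss_bin K (\dim U - 1) (a%:Z - 1))%:Z.
Proof.
move=> nzv vU; have := card_vspace_interval (Posz a) (vU : (<[v]> <= U)%VS).
rewrite dim_vline nzv => <-; rewrite -sum1_card -natz natr_sum.
rewrite big_mkcond [RHS]big_mkcond; apply: eq_bigr => X _.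
by rewrite inE eqz_nat -memvE -andbA; case: (v \in X); case: (andb _ _).
Qed.

(** The hypothesis q + p <= n makes the truncated subtraction in
    n - a - b + 1 exact throughout the range of summation. *)
Lemma card_trivial_meets_line (K : finFieldType) (vT : vectType K)
    (U V : {vspace vT}) (v : vT) (n m p q : nat) :
  v != 0 -> (U :&: V)%VS = <[v]>%VS -> \dim {:vT} = n -> \dim U = q ->
  \dim V = p -> (q + p <= n)%N ->
  #|[set A : {vspace vT} |
      [&& (U :&: A)%VS == 0%VS, (V :&: A)%VS == 0%VS & \dim A == m]]|%:Z =
  \sum_(0 <= a < q.+1) \sum_(0 <= b < p.+1)
    (-1) ^+ (a + b) * #|K|%:Z ^+ ('C(a, 2) + 'C(b, 2)) *
    (N0 K p q a b * (gauss_bin K (n - a - b) (m%:Z - a%:Z - b%:Z))%:Z +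
     N1 K p q a b *
       (gauss_bin K (n - a - b + 1) (m%:Z - a%:Z - b%:Z + 1))%:Z).
Proof.
move=> nzv UV dimT dimU dimV le_qpn.
have /andP[vU vV] : (v \in U) && (v \in V) by rewrite -memv_cap UV memv_line.
rewrite card_trivial_meets dimT sum_by_dim dimU.
apply: eq_big_nat => a /andP[_ lt_aq].
under eq_bigr do rewrite sum_by_dim dimV.
rewrite exchange_big; apply: eq_big_nat => b /andP[_ lt_bp] /=.
set G0 := gauss_bin K (n - a - b) _; set G1 := gauss_bin K (n - a - b + 1) _.
have dimXY (X Y : {vspace vT}) : (X <= U)%VS -> (Y <= V)%VS ->
    (\dim (X + Y) + ((v \in X) && (v \in Y)) = \dim X + \dim Y)%N.
  move=> sXU sYV; rewrite -dimv_sum_cap; congr (_ + _)%N.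
  have sXY : (X :&: Y <= <[v]>)%VS by rewrite -UV capvS.
  rewrite -memv_cap; have [vXY | vXY] := boolP (v \in _).
    have -> : (X :&: Y)%VS = <[v]>%VS by apply/eqP; rewrite eqEsubv sXY.
    by rewrite dim_vline nzv.
  by rewrite -(capv_idPl sXY) disjoint_line // dimv0.
set c := (-1) ^+ (a + b) * #|K|%:Z ^+ ('C(a, 2) + 'C(b, 2)); have cE := erefl c.
rewrite {2}/c in cE; clearbody c.
(* the pair X, Y counts G1 if both contain v and G0 otherwise; written as
   G0 + [v in X] [v in Y] (G1 - G0), the double sum factors *)
transitivity (\sum_(X : {vspace vT} | (X <= U)%VS && (\dim X == a))
    \sum_(Y : {vspace vT} | (Y <= V)%VS && (\dim Y == b))
      (c * G0%:Z * (1 * 1) + c * (G1%:Z - G0%:Z) * ((v \in X)%:R * (v \in Y)%:R))).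
  apply: eq_bigr => X /andP[sXU /eqP dimX]; apply: eq_bigr => Y /andP[sYV /eqP dimY].
  rewrite /vmoebius dimX dimY -natrM mulnb.
  have -> : (-1) ^+ a * #|K|%:Z ^+ 'C(a, 2) * ((-1) ^+ b * #|K|%:Z ^+ 'C(b, 2)) = c.
    by rewrite cE !exprD mulrACA.
  have := dimXY X Y sXU sYV; rewrite dimX dimY /G0 /G1 -!subnDA.
  have -> : (m%:Z - a%:Z - b%:Z) = m%:Z - (a + b)%N%:Z by rewrite PoszD; ring.
  have le_abn : (a + b <= n)%N by apply: leq_trans le_qpn; apply: leq_add.
  case: (andb _ _) => [|]; rewrite ?addn0 => dXY.
    rewrite -dXY in le_abn *; rewrite PoszD.
    have -> : (n - (\dim (X + Y) + 1) + 1 = n - \dim (X + Y))%N.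
      by rewrite subnDA subnK // subn_gt0 -addn1.
    have -> : m%:Z - ((\dim (X + Y)%VS)%:Z + 1%:Z) + 1 = m%:Z - (\dim (X + Y)%VS)%:Z by ring.
    by rewrite /= mulr1n; ring.
  by rewrite dXY /= mulr0n; ring.
under eq_bigr do rewrite big_split /= -!mulr_sumr gauss_bin_vspace gauss_bin_vspace_line // !mulrA.
rewrite big_split /= -[X in X + _]mulr_suml -[X in _ + X]mulr_suml -!mulr_sumr gauss_bin_vspace gauss_bin_vspace_line //.
rewrite dimU dimV /N0 /N1 !PoszM.
ring.
Qed.

(** * Subfields of a finite extension of a finite field *)

Lemma divn_inj (n d e : nat) :
  (0 < n)%N -> (d %| n)%N -> (e %| n)%N -> (n %/ d = n %/ e)%N -> d = e.
Proof.
move=> n_gt0 dvd_d dvd_e eq_de.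
have nd_gt0 : (0 < n %/ d)%N.
  by have := divnK dvd_d; case: (n %/ d)%N => // n0; rewrite -n0 in n_gt0.
by apply/eqP; rewrite -(eqn_pmul2l nd_gt0) {2}eq_de !divnK.
Qed.

(** The Galois group is cyclic of order \dim {:L}; the subfield of dimension d is
    the fixed field of the subgroup of index d. *)
Lemma subfield_of_dim_exists (K : finFieldType) (L : fieldExtType K) (d : nat) :
  (d %| \dim {:L})%N -> exists E : {subfield L}, \dim E = d.
Proof.
(* Galois theory is stated for splitting fields, and L is one *)
wlog [galL -> {L}] : L / exists galL : splittingFieldType K, L = galL.
  by pose galL := FinSplittingFieldType K L => /(_ galL); apply; exists galL.
move=> dvd_d; have n_gt0 : (0 < \dim {:galL})%N by apply: adim_gt0.
have d_gt0 : (0 < d)%N by apply: dvdn_gt0 dvd_d.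
have gal1 : galois 1 {:galL} by apply: finField_galois (sub1v _).
have [alpha /eqP genalpha _] := finField_galois_generator (sub1v {:galL}).
have ord_alpha : #[alpha]%g = \dim {:galL}.
  by rewrite orderE -genalpha -(galois_dim gal1) dimv1 divn1.
exists (fixedField <[alpha ^+ d]>%g).
have dvdF : (\dim (fixedField <[alpha ^+ d]>%g) %| \dim {:galL})%N.
  by apply: field_dimS (subvf _).
have eqD := dim_fixedField <[alpha ^+ d]>%g.
rewrite -orderE orderXdiv ord_alpha // in eqD.
exact: esym (divn_inj n_gt0 dvd_d dvdF eqD).
Qed.

(** A subfield E is the set of fixed points of x |-> x ^+ (#|K| ^ \dim E), and
    when \dim E divides \dim F, the map attached to F is an iterate of the one
    attached to E. *)
Lemma subfield_sub_of_dvd (K : finFieldType) (L : fieldExtType K)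
    (E F : {subfield L}) : (\dim E %| \dim F)%N -> (E <= F)%VS.
Proof.
case/dvdnP=> k dimF; apply/subvP => x; rewrite !Fermat's_little_theorem /order.
move=> /eqP xE; rewrite dimF mulnC; elim: k {dimF} => [|k IHk].
  by rewrite muln0 expr1.
by rewrite mulnS expnD exprM xE.
Qed.

Lemma capv_coprime_subfields (K : fieldType) (L : fieldExtType K)
    (E F : {subfield L}) :
  coprime (\dim E) (\dim F) -> (E :&: F)%VS = <[1 : L]>%VS.
Proof.
move=> coEF; apply/eqP; rewrite eq_sym eqEdim -memvE mem1v dim_vline oner_neq0 /=.
rewrite dvdn_leq // -(eqP coEF) dvdn_gcd.
by rewrite !(@field_dimS _ _ (E :&: F)%AS) ?capvSl ?capvSr.
Qed.

Lemma dvdn_prime_mul (p q d : nat) : prime p -> prime q -> (d %| p * q)%N ->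
  [\/ d %| p, d %| q | d = p * q]%N.
Proof.
move=> p_prime q_prime dvd_d; have [q_d | nq_d] := boolP (q %| d)%N.
  have [e dE] := dvdnP q_d; move: dvd_d; rewrite dE dvdn_pmul2r ?prime_gt0 //.
  move=> /(primeP p_prime).2 /orP[] /eqP ->; last by constructor 3.
  by constructor 2; rewrite mul1n.
by constructor 1; rewrite -(Gauss_dvdl p (_ : coprime d q)) // coprime_sym prime_coprime.
Qed.

(** A nonzero a in A has degree p * q > m unless this degree divides p or q, and
    then K(a) lies in E or in F.  Conversely, an element of E or F has degree at
    most m. *)
Lemma chowlab_dim (K : finFieldType) (L : fieldExtType K) (p q m : nat)
    (E F : {subfield L}) (A : {vspace L}) :
  prime p -> prime q -> \dim {:L} = (p * q)%N -> \dim E = p -> \dim F = q ->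
  (p <= m)%N -> (q <= m)%N -> (m < p * q)%N -> \dim A = m ->
  chowlab A = ((F :&: A)%VS == 0%VS) && ((E :&: A)%VS == 0%VS).
Proof.
move=> p_prime q_prime dimL dimE dimF le_pm le_qm lt_mpq dimA.
apply/chowlaP/andP => [[nzA chowA] | [/eqP FA0 /eqP EA0]].
  have meet0 (M : {subfield L}) : (\dim M <= m)%N -> (M :&: A)%VS == 0%VS.
    move=> le_Mm; rewrite -subv0; apply/subvP => a.
    rewrite memv_cap memv0 => /andP[aM aA]; apply/idPn => nza.
    have := chowA a aA nza; rewrite dimA ltnNge => /negP[].
    by apply: leq_trans (dimvS _) le_Mm; apply/FadjoinP; rewrite sub1v.
  by rewrite !meet0 ?dimE ?dimF.
split=> [|a aA nza].
  by rewrite -dimv_eq0 dimA -lt0n (leq_trans (prime_gt0 p_prime)).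
have notin (M : {subfield L}) : (M :&: A)%VS = 0%VS -> ~~ (\dim <<1; a>>%AS %| \dim M)%N.
  move=> MA0; apply: contra nza => /subfield_sub_of_dvd /subvP/(_ a (memv_adjoin 1 a)) aM.
  by rewrite -memv0 -MA0 memv_cap aM.
have := field_dimS (subvf <<1; a>>%AS); rewrite dimL.
case/(dvdn_prime_mul p_prime q_prime) => [dvd | dvd | ->]; last by rewrite dimA.
  by have := notin E EA0; rewrite dimE dvd.
by have := notin F FA0; rewrite dimF dvd.
Qed.

(* For primes p < q and a, b in the range of summation, the truncated
   difference p * q - a - b is exact, since p + q <= p * q. *)
Theorem theorem5p8 (p q Q : nat) (K : finFieldType) (L : fieldExtType K)
    (p_prime : prime p) (q_prime : prime q) (lt_pq : (p < q)%N)
    (cardK : #|K| = Q) (dimL : \dim {:L} = (p * q)%N)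
    (m : nat) (le_qm : (q <= m)%N) (lt_mpq : (m < p * q)%N) :
  #|[set A : {vspace L} | chowlab A & \dim A == m]|%:Z =
  \sum_(0 <= a < q.+1) \sum_(0 <= b < p.+1)
    (-1) ^+ (a + b) * Q%:Z ^+ ('C(a, 2) + 'C(b, 2)) *
    (N0 K p q a b *
       (gauss_bin K (p * q - a - b) (m%:Z - a%:Z - b%:Z))%:Z +
     N1 K p q a b *
       (gauss_bin K (p * q - a - b + 1) (m%:Z - a%:Z - b%:Z + 1))%:Z).
Proof.
have [E dimE] : exists E : {subfield L}, \dim E = p.
  by apply: subfield_of_dim_exists; rewrite dimL dvdn_mulr.
have [F dimF] : exists F : {subfield L}, \dim F = q.
  by apply: subfield_of_dim_exists; rewrite dimL dvdn_mull.
have FE1 : (F :&: E)%VS = <[1 : L]>%VS.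
  apply: capv_coprime_subfields; rewrite dimE dimF prime_coprime // dvdn_prime2 //.
  by rewrite gtn_eqF.
have le_sum : (q + p <= p * q)%N.
  apply: leq_trans (_ : (2 * q <= p * q)%N); last by rewrite leq_mul2r prime_gt1 ?orbT.
  by rewrite mul2n -addnn leq_add2l ltnW.
rewrite -cardK -(card_trivial_meets_line m (oner_neq0 L) FE1 dimL dimF dimE le_sum).
congr (Posz #|pred_of_set _|); apply/setP => A; rewrite !inE andbA.
apply: andb_id2r => /eqP dimA.
by rewrite (chowlab_dim p_prime q_prime dimL dimE dimF _ le_qm) // (leq_trans (ltnW lt_pq)).
Qed.
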